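(* There is an absolute constant $c>0$ such that for all sufficiently large $n$, every deterministic truthful mechanism for the matching market with $n$ agents and $n$ items has rank-approximation factor at least $c\cdot\frac{\log\log n}{\log\log\log n}$.
   Context: Matching market: $n$ agents and $m$ items (here $m=n$); each agent $j$ reports any strict total order $\succ_j$ on the items. An outcome is a matching; an unmatched agent receives the null item, ranked below every item. A deterministic mechanism maps each profile to a matching; it is truthful if for every agent $j$, $\succ_{-j}$, and $\succ_j,\succ'_j$, the item $j$ receives under $(\succ_j,\succ_{-j})$ is weakly preferred under $\succ_j$ to the item $j$ receives under $(\succ'_j,\succ_{-j})$. $\mathrm{rank}_i(M;\succ)$ is the number of agents assigned one of their top-$i$ items by $M$, $\mathrm{maxrank}_i(\succ)$ its maximum over matchings; a mechanism has rank-approximation factor $\alpha$ if on every profile its output satisfies $\mathrm{rank}_i\ge\mathrm{maxrank}_i/\alpha$ for all $i$. *)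

(* Defs.v *)
From mathcomp Require Import all_boot all_fingroup.
From Stdlib Require Import Reals.
Set Implicit Arguments. Unset Strict Implicit. Unset Printing Implicit Defensive.

(* Agents and items are both 'I_n.  A strict total order on items is encoded
   by a permutation r : {perm 'I_n}: r x is the position of item x in the
   ranking (0 = most preferred). *)
Definition pref n := {perm 'I_n}.
Definition profile n := {ffun 'I_n -> pref n}.
(* An outcome assigns to each agent an item (Some x) or the null item (None). *)
Definition outcome n := {ffun 'I_n -> option 'I_n}.

Definition is_matching n (mu : outcome n) : bool :=
  [forall a, forall b, forall x,
     (mu a == Some x) && (mu b == Some x) ==> (a == b)].

Definition pos n (r : pref n) (o : option 'I_n) : nat :=
  if o is Some x then r x else n.

Definition weakly_prefers n (r : pref n) (o1 o2 : option 'I_n) : bool :=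
  pos r o1 <= pos r o2.

Definition mechanism n := profile n -> outcome n.

Definition deterministic_mechanism n (M : mechanism n) : Prop :=
  forall P, is_matching (M P).

Definition update n (P : profile n) (j : 'I_n) (r' : pref n) : profile n :=
  [ffun k => if k == j then r' else P k].

Definition truthful n (M : mechanism n) : Prop :=
  forall (j : 'I_n) (P : profile n) (r' : pref n),
    weakly_prefers (P j) (M P j) (M (update P j r') j).

Definition rank_i n (i : nat) (mu : outcome n) (P : profile n) : nat :=
  #|[set j : 'I_n | if mu j is Some x then P j x < i else false]|.

Definition maxrank_i n (i : nat) (P : profile n) : nat :=
  \max_(mu : outcome n | is_matching mu) rank_i i mu P.

Definition rank_approx n (M : mechanism n) (alpha : R) : Prop :=
  (0 < alpha)%R /\
  forall (P : profile n) (i : nat),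
    (INR (maxrank_i i P) / alpha <= INR (rank_i i (M P) P))%R.

(* Main.v *)
Require Import Defs.
From mathcomp Require Import all_boot all_fingroup.
From Stdlib Require Import Reals.
From Stdlib Require Import Lra.

Set Implicit Arguments.
Unset Strict Implicit.
Unset Printing Implicit Defensive.

(** The bound only uses rank 1, and in fact gives a factor of order n^(1/3).
    Take k disjoint blocks of b > k^2 agents and let every agent rank the items
    in the same order x_0, x_1, ..., except for one agent f(t) in each block t,
    who ranks x_t first.  Suppose f(t) is given x_t.  By truthfulness, with the
    common ranking it would be given one of x_0, ..., x_t; the profile obtained
    in this way does not depend on f(t), so, the other choices being fixed, this
    happens for at most t + 1 <= k of the b possible f(t).  A union bound over t
    yields an f for which no f(t) is given x_t.  Then only the agent given x_0 can
    have its first choice, whereas a matching can give all k agents f(t) theirs. *)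

Section Blocks.

Variables (n k b : nat) (M : mechanism n).
Variables (agent : 'I_k.+1 -> 'I_b -> 'I_n) (item : 'I_k.+1 -> 'I_n).
Hypothesis agent_inj : forall t u t' u',
  agent t u = agent t' u' -> t = t' /\ u = u'.
Hypothesis itemE : forall t, item t = t :> nat.
Hypothesis M_matching : deterministic_mechanism M.
Hypothesis M_truthful : truthful M.

Implicit Types (f : {ffun 'I_k.+1 -> 'I_b}) (t : 'I_k.+1).

Definition top_pref t : pref n := tperm (item ord0) (item t).

(** Since [agent] is injective, at most one [t] qualifies, so [pick] makes no real choice. *)
Definition block_profile f : profile n :=
  [ffun j => if [pick t | agent t (f t) == j] is Some t then top_pref t
             else 1%g].

Definition block_profile_but t f : profile n :=
  [ffun j => if [pick s | (s != t) && (agent s (f s) == j)] is Some s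
             then top_pref s else 1%g].

Definition replace t f v : {ffun 'I_k.+1 -> 'I_b} :=
  [ffun s => if s == t then v else f s].

Lemma item_inj : injective item.
Proof. by move=> s t /(congr1 val); rewrite /= !itemE => /val_inj. Qed.

Lemma matching_inj P a c x : M P a = Some x -> M P c = Some x -> a = c.
Proof.
move=> ha hc; have /forallP/(_ a)/forallP/(_ c)/forallP/(_ x) := M_matching P.
by rewrite ha hc eqxx /= => /eqP.
Qed.

Lemma top_pref_eq0 t (x : 'I_n) : (top_pref t x == 0 :> nat) = (x == item t).
Proof.
rewrite -(inj_eq (@perm_inj _ (top_pref t))) tpermR.
by rewrite -[RHS](inj_eq val_inj) /= itemE.
Qed.

Lemma block_profile_agent f t : block_profile f (agent t (f t)) = top_pref t.
Proof.
rewrite ffunE; case: pickP => [s /eqP /agent_inj[-> //]|/(_ t)].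
by rewrite eqxx.
Qed.

Lemma update_block_profile_but t f :
  update (block_profile_but t f) (agent t (f t)) (top_pref t)
  = block_profile f.
Proof.
apply/ffunP => j; rewrite ffunE; case: eqP => [->|/eqP jNt].
  by rewrite block_profile_agent.
rewrite !ffunE; congr (if _ is Some s then _ else _); apply: eq_pick => s /=.
by case: eqP => //= ->; rewrite eq_sym (negbTE jNt).
Qed.

Lemma block_profile_but_replace t f v :
  block_profile_but t (replace t f v) = block_profile_but t f.
Proof.
apply/ffunP => j; rewrite !ffunE; congr (if _ is Some s then _ else _).
by apply: eq_pick => s /=; rewrite ffunE; case: eqP.
Qed.

Definition wins t f := M (block_profile f) (agent t (f t)) == Some (item t).

(** From the common ranking, this agent could report [top_pref t] and obtain [item t], which has
    position [t] in the common ranking; truthfulness bounds the position of what it gets by [t]. *)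
Lemma wins_item t f : wins t f ->
  exists w, M (block_profile_but t f) (agent t (f t)) = Some (item w).
Proof.
move=> /eqP wf.
have := M_truthful (agent t (f t)) (block_profile_but t f) (top_pref t).
rewrite update_block_profile_but wf /weakly_prefers ffunE.
case: pickP => [s /andP[sNt /eqP/agent_inj[/eqP]]|_]; first by rewrite (negbTE sNt).
case: (M _ _) => [x|] /=; rewrite !perm1 itemE; last first.
  (* The null item has position [n], beyond that of [item t]. *)
  by rewrite leqNgt -itemE ltn_ord.
move=> le_xt; have lt_xk : x < k.+1 by apply: leq_ltn_trans le_xt (ltn_ord t).
by exists (Ordinal lt_xk); congr Some; apply: val_inj; rewrite /= itemE.
Qed.

Lemma card_wins t :
  #|[set f | wins t f]| * b <= #|{ffun 'I_k.+1 -> 'I_b}| * k.+1.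
Proof.
(* A pair (f, v) with f winning is determined by f with f(t) replaced by v and
   the item w that agent f(t) gets when reporting the common ranking: that
   profile ignores f(t), so its matching and w give back f(t). *)
pose won f := [pick w | M (block_profile_but t f) (agent t (f t)) == Some (item w)].
pose h (p : {ffun 'I_k.+1 -> 'I_b} * 'I_b) :=
  (replace t p.1 p.2, odflt ord0 (won p.1)).
have h_inj : {in setX [set f | wins t f] [set: 'I_b] &, injective h}.
  move=> [f v] [g w]; rewrite !inE !andbT /= => wf wg [efg].
  have /(congr1 (fun g : {ffun _} => g t)) := efg; rewrite !ffunE eqxx => ->.
  (* By [wins_item] both picks succeed, so the default [ord0] never interferes. *)
  rewrite /won; have [x xf] := wins_item wf; have [y yg] := wins_item wg.
  case: pickP => [s /eqP Ms|/(_ x)]; last by rewrite xf eqxx.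
  case: pickP => [s' /eqP Ms'|/(_ y)]; last by rewrite yg eqxx.
  move=> /= ess; move: Ms'; rewrite -ess.
  rewrite -(block_profile_but_replace t g w) -efg block_profile_but_replace.
  move=> /(matching_inj Ms)/agent_inj[_ eft].
  congr pair; apply/ffunP => s0; case: (eqVneq s0 t) => [-> //|sNt].
  by have /(congr1 (fun g : {ffun _} => g s0)) := efg; rewrite !ffunE (negbTE sNt).
have := max_card (h @: setX [set f | wins t f] [set: 'I_b]).
by rewrite card_in_imset // cardsX cardsT card_ord card_prod card_ord.
Qed.

Lemma exists_no_win : k.+1 * k.+1 < b -> exists f, forall t, ~~ wins t f.
Proof.
move=> lt_kb; suff /existsP[f /forallP] : [exists f, [forall t, ~~ wins t f]].
  by exists f.
apply: contraLR lt_kb; rewrite negb_exists -leqNgt => /forallP some_win.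
have [->//|b_gt0] := posnP b.
have F_gt0 : 0 < #|{ffun 'I_k.+1 -> 'I_b}|.
  by rewrite card_ffun !card_ord expn_gt0 b_gt0.
rewrite -(leq_pmul2l F_gt0).
(* Double counting: if every [f] wins somewhere, the sets of winning choices cover all [f], and
   [card_wins] bounds each of them. *)
apply: (@leq_trans ((\sum_t #|[set f | wins t f]|) * b)).
  rewrite leq_mul2r; apply/orP; right.
  under eq_bigr do rewrite -sum1dep_card big_mkcond.
  rewrite exchange_big -sum1_card leq_sum // => f _.
  have := some_win f; rewrite negb_forall => /existsP[t]; rewrite negbK => wf.
  by rewrite (bigD1 t) //= wf.
rewrite big_distrl (leq_trans (leq_sum _ (fun t _ => card_wins t))) //.
by rewrite sum_nat_const card_ord mulnCA.
Qed.

Lemma rank1_no_win f :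
  (forall t, ~~ wins t f) -> rank_i 1 (M (block_profile f)) (block_profile f) <= 1.
Proof.
move=> no_win.
have first j : (if M (block_profile f) j is Some x then block_profile f j x < 1
                else false) -> M (block_profile f) j = Some (item ord0).
  case Mj: (M _ j) => [x|//]; rewrite ltnS leqn0 ffunE.
  case: pickP => [t /eqP jE|_]; last first.
    by rewrite perm1 => /eqP x0; congr Some; apply: val_inj; rewrite /= x0 itemE.
  rewrite top_pref_eq0 => /eqP xE; have := no_win t.
  by rewrite /wins jE Mj xE eqxx.
apply/card_le1_eqP => i j; rewrite !inE => /first Mi /first Mj.
exact: matching_inj Mj Mi.
Qed.

Lemma maxrank1_block f : k.+1 <= maxrank_i 1 (block_profile f).
Proof.
pose mu : outcome n :=
  [ffun j => omap item [pick t | agent t (f t) == j]].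
have muE j x : mu j = Some x -> exists2 t, j = agent t (f t) & x = item t.
  by rewrite ffunE; case: pickP => //= t /eqP <- [<-]; exists t.
have mu_agent t : mu (agent t (f t)) = Some (item t).
  rewrite ffunE; case: pickP => [s /eqP/agent_inj[-> //]|/(_ t)].
  by rewrite eqxx.
have mu_matching : is_matching mu.
  apply/forallP => i; apply/forallP => j; apply/forallP => x; apply/implyP.
  by move=> /andP[/eqP/muE[s -> ->] /eqP/muE[t -> /item_inj->]].
apply: (@leq_trans (rank_i 1 mu (block_profile f))); last exact: leq_bigmax_cond.
rewrite -[k.+1]card_ord -(card_imset _ (f := fun t => agent t (f t))); last first.
  by move=> s t /agent_inj[].
apply: subset_leq_card; apply/subsetP => _ /imsetP[t _ ->]; rewrite inE mu_agent.
by rewrite block_profile_agent ltnS leqn0 top_pref_eq0.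
Qed.

End Blocks.

Lemma truthful_rank_approx n k (M : mechanism n) (alpha : R) :
  k.+1 * (k.+1 * k.+1).+1 <= n -> deterministic_mechanism M -> truthful M ->
  rank_approx M alpha -> (INR k.+1 <= alpha)%R.
Proof.
move=> le_kn M_matching M_truthful [alpha_gt0 approx].
(* The smallest block size that [exists_no_win] accepts. Agents are numbered [t * b + u], so
   division by [b] recovers block and place. *)
set b := (k.+1 * k.+1).+1 in le_kn.
have agent_lt (t : 'I_k.+1) (u : 'I_b) : t * b + u < n.
  apply: leq_trans le_kn; apply: (@leq_trans (t.+1 * b)).
    by rewrite mulSn addnC ltn_add2r.
  by rewrite leq_mul2r ltn_ord orbT.
have le_k_n : k.+1 <= n by apply: leq_trans le_kn; rewrite leq_pmulr.
pose agent t u := Ordinal (agent_lt t u).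
have agent_inj t u t' u' : agent t u = agent t' u' -> t = t' /\ u = u'.
  move=> /(congr1 val) /= e; split; apply: val_inj => /=.
    have /(congr1 (divn^~ b)) := e; rewrite !divnMDl //.
    by rewrite !divn_small ?addn0.
  have /(congr1 (modn^~ b)) := e; rewrite !modnMDl.
  by rewrite !modn_small.
have itemE (t : 'I_k.+1) : widen_ord le_k_n t = t :> nat by [].
have [f no_win] := exists_no_win agent_inj itemE M_matching M_truthful (ltnSn _).
have le_rank := rank1_no_win itemE M_matching no_win.
have le_max := maxrank1_block agent_inj itemE f.
have := approx (block_profile agent (widen_ord le_k_n) f) 1.
move: le_rank le_max => /leP/le_INR le_rank /leP/le_INR le_max le_approx.
have max_le : (INR (maxrank_i 1 (block_profile agent (widen_ord le_k_n) f))
               <= 1 * alpha)%R.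
  apply: (Rmult_le_reg_r (/ alpha)); first exact: Rinv_0_lt_compat.
  by rewrite Rmult_assoc Rinv_r; move: le_approx le_rank; rewrite /Rdiv /=; lra.
lra.
Qed.

(** Take the largest [k] whose blocks fit. Those of [k.+1] do not, and their total size is rounded
    up to a pure cube, whose logarithm is simple. *)
Lemma cube_bracket n : 2 <= n ->
  exists k, k.+1 * (k.+1 * k.+1).+1 <= n < k.+3 * (k.+3 * k.+3).
Proof.
move=> n_ge2; have ex0 : exists k, k.+1 * (k.+1 * k.+1).+1 <= n by exists 0.
have bound k : k.+1 * (k.+1 * k.+1).+1 <= n -> k <= n.
  by move=> le_kn; apply: ltnW (leq_trans _ le_kn); rewrite leq_pmulr.
case: (ex_maxnP ex0 bound) => k le_kn max_k; exists k; rewrite le_kn /=.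
rewrite ltnNge; apply/negP => ge_n; have := max_k k.+1; rewrite ltnn => imp.
apply: notF; apply: imp; apply: leq_trans ge_n.
by rewrite leq_mul // ltn_mul.
Qed.

Lemma ln_le_sub1 (x : R) : (0 < x)%R -> (ln x <= x - 1)%R.
Proof.
move=> x_gt0; have := exp_ineq1_le (ln x); rewrite exp_ln //; lra.
Qed.

Theorem theorem9 :
  exists c : R, (0 < c)%R /\
  exists N : nat, forall n : nat, (N <= n)%N ->
    forall M : mechanism n,
      deterministic_mechanism M -> truthful M ->
      forall alpha : R, rank_approx M alpha ->
        (c * (ln (ln (INR n)) / ln (ln (ln (INR n)))) <= alpha)%R.
Proof.
(* This threshold makes the triple logarithm exceed 1, so dividing by it only lowers the bound. *)
have [N N_large] := INR_unbounded (exp (exp (exp 1))).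
(* The constant comes from [ln (ln n) <= ln n - 1 <= 3 * (k + 2) - 1 <= 6 * (k + 1)]. *)
exists (/ 6)%R; split; first lra.
exists (maxn N 2) => n; rewrite geq_max => /andP[le_Nn n_ge2] M M_matching M_truthful.
move=> alpha /(truthful_rank_approx _ M_matching M_truthful) k_le_alpha.
have [k /andP[le_kn lt_nk]] := cube_bracket n_ge2.
have {k_le_alpha} := k_le_alpha k le_kn.
move/leP/le_INR: le_Nn => le_Nn; rewrite S_INR => k_le_alpha.
have k_ge0 := pos_INR k.
have lt_n : (INR n < (INR k + 3) ^ 3)%R.
  have -> : ((INR k + 3) ^ 3 = INR (k.+3 * (k.+3 * k.+3)))%R.
    by rewrite !mult_INR !S_INR; ring.
  by apply: lt_INR; apply/ltP.
have n_gt : (exp (exp (exp 1)) < INR n)%R by lra.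
have ln_lt (x y : R) : (exp x < y -> x < ln y)%R.
  by move=> lt_xy; rewrite -[x]ln_exp; apply: ln_increasing => //; apply: exp_pos.
have ln_n := ln_lt _ _ n_gt; have lnln_n := ln_lt _ _ ln_n.
have lnlnln_n := ln_lt _ _ lnln_n.
have e1 := exp_pos 1; have e2 := exp_pos (exp 1); have e3 := exp_pos (exp (exp 1)).
have le_lnln : (ln (ln (INR n)) <= ln (INR n) - 1)%R by apply: ln_le_sub1; lra.
have le_ln : (ln (INR n) <= 3 * (INR k + 2))%R.
  apply: (Rle_trans _ (ln ((INR k + 3) ^ 3))).
    by left; apply: ln_increasing => //; lra.
  rewrite ln_pow; last lra.
  have := @ln_le_sub1 (INR k + 3); rewrite /=; lra.
apply: (Rle_trans _ (/ 6 * ln (ln (INR n)))); last lra.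
apply: Rmult_le_compat_l; first lra.
rewrite /Rdiv -[X in (_ <= X)%R]Rmult_1_r; apply: Rmult_le_compat_l; first lra.
by rewrite -Rinv_1; apply: Rinv_le_contravar; lra.
Qed.
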